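(* Let $t\in\{2,\dots,T-1\}$, let $\boldsymbol{x}_{t-1}$ be a feasible previous-stage state and let $\boldsymbol{\xi}_t\in\Xi_t$. Suppose that the ambiguity sets in the value-function recursion are of Type 3, $\mathcal{P}_{t+1}(\boldsymbol{x}_t)=\mathcal{P}^{D_3}_{t+1}(\boldsymbol{x}_t)$, where $\mathcal{P}^{D_3}_{t+1}(\boldsymbol{x}_t)$ is the set of $\boldsymbol{p}\in\mathbb{R}^K_+$ satisfying $$\sum_{k=1}^Kp_k=1,\qquad \Big(\sum_{k=1}^K p_k\boldsymbol{\xi}_{t+1}^k-\boldsymbol{\mu}(\boldsymbol{x}_t)\Big)^{\mathsf T}\boldsymbol{\Sigma}(\boldsymbol{x}_t)^{-1}\Big(\sum_{k=1}^K p_k\boldsymbol{\xi}_{t+1}^k-\boldsymbol{\mu}(\boldsymbol{x}_t)\Big)\le\gamma,$$ $$\sum_{k=1}^Kp_k(\boldsymbol{\xi}_{t+1}^k-\boldsymbol{\mu}(\boldsymbol{x}_t))(\boldsymbol{\xi}_{t+1}^k-\boldsymbol{\mu}(\boldsymbol{x}_t))^{\mathsf T}\preceq\eta\boldsymbol{\Sigma}(\boldsymbol{x}_t).$$ Suppose that Slater's condition holds: for every feasible $\boldsymbol{x}_t\in\hat X_t(\boldsymbol{x}_{t-1},\boldsymbol{\xi}_t)$ there exists $\boldsymbol{p}\in\mathbb{R}^K_+$ with $\sum_{k}p_k=1$ satisfying the second constraint with strict inequality $<\gamma$ and the third with $\prec\eta\boldsymbol{\Sigma}(\boldsymbol{x}_t)$.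 Then $Q_t(\boldsymbol{x}_{t-1},\boldsymbol{\xi}_t)$ equals the optimal value of $$\begin{aligned} \min_{\boldsymbol{x}_t,\boldsymbol{y}_t,s,\boldsymbol{Z},\boldsymbol{Y}}\quad & g_t(\boldsymbol{x}_t,\boldsymbol{y}_t)+s+\boldsymbol{\Sigma}(\boldsymbol{x}_t)\bullet\boldsymbol{z}_1-2\boldsymbol{\mu}(\boldsymbol{x}_t)^{\mathsf T}\boldsymbol{z}_2+\gamma z_3+\eta\boldsymbol{\Sigma}(\boldsymbol{x}_t)\bullet\boldsymbol{Y}\\ \text{s.t.}\quad & s-2\boldsymbol{z}_2^{\mathsf T}\boldsymbol{\xi}_{t+1}^k+(\boldsymbol{\xi}_{t+1}^k-\boldsymbol{\mu}(\boldsymbol{x}_t))(\boldsymbol{\xi}_{t+1}^k-\boldsymbol{\mu}(\boldsymbol{x}_t))^{\mathsf T}\bullet\boldsymbol{Y}\ge Q_{t+1}(\boldsymbol{x}_t,\boldsymbol{\xi}_{t+1}^k),\quad k=1,\dots,K,\\ & \boldsymbol{Z}=\begin{pmatrix}\boldsymbol{z}_1&\boldsymbol{z}_2\\ \boldsymbol{z}_2^{\mathsf T}&z_3\end{pmatrix}\succeq0,\quad \boldsymbol{Y}\succeq0,\\ & (\boldsymbol{x}_t,\boldsymbol{y}_t)\in X_t(\boldsymbol{x}_{t-1},\boldsymbol{\xi}_t), \end{aligned}$$ where $s\in\mathbb{R}$, $\boldsymbol{z}_1\in\mathbb{R}^{J\times J}$, $\boldsymbol{z}_2\in\mathbb{R}^J$,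 $z_3\in\mathbb{R}$, $\boldsymbol{Y}\in\mathbb{R}^{J\times J}$.
   Context: Setting (multistage decision-dependent distributionally robust mixed-integer program). Fix positive integers $T,I,J,K$. At each stage $t\in\{1,\dots,T\}$ the decisions are a binary state variable $\boldsymbol{x}_t\in\{0,1\}^I$ and a stage variable $\boldsymbol{y}_t\in\mathbb{R}^{I\times J}$ (components integer or continuous). $\boldsymbol{\xi}_1$ is deterministic; for $t\ge2$, $\boldsymbol{\xi}_t$ is a random vector with finite, decision-independent support $\Xi_t=\{\boldsymbol{\xi}_t^1,\dots,\boldsymbol{\xi}_t^K\}\subset\mathbb{R}^J$, and the $\boldsymbol{\xi}_t$ are stage-wise independent. The cost $g_t(\boldsymbol{x}_t,\boldsymbol{y}_t)$ is linear. The feasible set $X_t(\boldsymbol{x}_{t-1},\boldsymbol{\xi}_t)\subset\{0,1\}^I\times\mathbb{R}^{I\times J}$ is a non-empty compact mixed-integer polyhedral set for every feasible $\boldsymbol{x}_{t-1}$ and every realization $\boldsymbol{\xi}_t$ (complete recourse: every stage subproblem is always feasible). $\hat X_t(\boldsymbol{x}_{t-1},\boldsymbol{\xi}_t)$ denotes the projection of $X_t(\boldsymbol{x}_{t-1},\boldsymbol{\xi}_t)$ onto the $\boldsymbol{x}_t$-space. A probability distribution on $\Xi_{t+1}$ is identified with a vector $\boldsymbol{p}=(p_1,\dots,p_K)$, $p_k$ being the probability of $\boldsymbol{\xi}_{t+1}^k$. For each stage, $\mathcal{P}_{t+1}(\boldsymbol{x}_t)$ is a set of such distributions (ambiguity set)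 depending on $\boldsymbol{x}_t$. Value functions are defined by $$Q_T(\boldsymbol{x}_{T-1},\boldsymbol{\xi}_T)=\min_{(\boldsymbol{x}_T,\boldsymbol{y}_T)\in X_T(\boldsymbol{x}_{T-1},\boldsymbol{\xi}_T)} g_T(\boldsymbol{x}_T,\boldsymbol{y}_T),$$ and for $t=2,\dots,T-1$ by the Bellman equation $$Q_t(\boldsymbol{x}_{t-1},\boldsymbol{\xi}_t)=\min_{(\boldsymbol{x}_t,\boldsymbol{y}_t)\in X_t(\boldsymbol{x}_{t-1},\boldsymbol{\xi}_t)}\Big\{g_t(\boldsymbol{x}_t,\boldsymbol{y}_t)+\max_{\boldsymbol{p}\in\mathcal{P}_{t+1}(\boldsymbol{x}_t)}\sum_{k=1}^Kp_k\,Q_{t+1}(\boldsymbol{x}_t,\boldsymbol{\xi}_{t+1}^k)\Big\}.$$ Type 3 data: $\boldsymbol{\mu}(\boldsymbol{x}_t)\in\mathbb{R}^J$ is a given decision-dependent mean estimate, $\boldsymbol{\Sigma}(\boldsymbol{x}_t)\in\mathbb{R}^{J\times J}$ a given decision-dependent symmetric positive definite covariance estimate, and $\gamma,\eta$ are real coefficients controlling the size of the ambiguity set. $\boldsymbol{A}\bullet\boldsymbol{B}=\mathrm{trace}(\boldsymbol{A}^{\mathsf T}\boldsymbol{B})$. For symmetric matrices, $A\preceq B$ (resp. $A\prec B$) means $B-A$ is positive semidefinite (resp. positive definite); $A\succeq 0$ means $A$ is symmetric positive semidefinite. *)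

(* Defs.v *)
From HB Require Import structures.
From mathcomp Require Import all_boot all_order all_algebra.
From mathcomp Require Import all_classical all_reals all_analysis.

Set Implicit Arguments.
Unset Strict Implicit.
Unset Printing Implicit Defensive.

Import Order.TTheory GRing.Theory Num.Theory.
Import numFieldNormedType.Exports.

Local Open Scope classical_set_scope.
Local Open Scope ring_scope.

Section Matrices.
Variable R : realType.

Definition psd n (A : 'M[R]_n) : Prop :=
  A^T = A /\ forall v : 'cV[R]_n, 0 <= (v^T *m A *m v) 0 0.

Definition posdef n (A : 'M[R]_n) : Prop :=
  A^T = A /\ forall v : 'cV[R]_n, v != 0 -> 0 < (v^T *m A *m v) 0 0.

(* [A] $\bullet$ [B] *)
Definition frob n (A B : 'M[R]_n) : R := \tr (A^T *m B).

Definition is_minimum (S : set R) (v : R) : Prop := S v /\ lbound S v.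

End Matrices.

Section Model.
Variables (R : realType) (I J K : nat).

(* $\{0,1\}^I$ is taken as a subset of $\mathbb{R}^I$. *)
Definition binary (x : 'cV[R]_I) : Prop := forall i, x i 0 = 0 \/ x i 0 = 1.

(* [N] is the set of the components of the stage variable that have to be
   integer; [mxvec] flattens the stage variable so that the linear constraints
   are $Ax + B\,\mathrm{vec}(y) \le b$. *)
Definition mixed_integer_polyhedral (N : {set 'I_I * 'I_J})
    (S : set ('cV[R]_I * 'M[R]_(I, J))) : Prop :=
  exists (m : nat) (A : 'M[R]_(m, I)) (B : 'M[R]_(m, I * J)) (b : 'cV[R]_m),
    S = [set z : 'cV[R]_I * 'M[R]_(I, J) |
         [/\ binary z.1,
             forall i j, (i, j) \in N -> z.2 i j \is a Num.int
           & forall r, (A *m z.1 + B *m (mxvec z.2)^T) r 0 <= b r 0]].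

(* Stages are numbered from 1 to [horizon]; [scenario t k] is used for
   [2 <= t] only, and [init] is the state given to the first stage. *)
Record problem := Problem {
  horizon : nat;
  init : 'cV[R]_I;
  xi1 : 'cV[R]_J;
  scenario : nat -> 'I_K -> 'cV[R]_J;
  integral_part : nat -> {set 'I_I * 'I_J};
  cost : nat -> {linear ('cV[R]_I * 'M[R]_(I, J))%type -> R^o};
  feas : nat -> 'cV[R]_I -> 'cV[R]_J -> set ('cV[R]_I * 'M[R]_(I, J))
}.

Section Problem.
Variable M : problem.

Definition realizations (t : nat) : set 'cV[R]_J :=
  if t == 1%N then [set xi1 M] else range (scenario M t).

(* $\hat X_t(x_{t-1}, \xi_t)$ *)
Definition feas_proj (t : nat) (x : 'cV[R]_I) (xi : 'cV[R]_J) : set 'cV[R]_I :=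
  [set x' | exists y, feas M t x xi (x', y)].

(* The states that some sequence of realizations and of feasible decisions
   leads to at the end of stage [t]. *)
Fixpoint feasible_state (t : nat) : set 'cV[R]_I :=
  if t is s.+1 then
    [set x' | exists x xi, [/\ feasible_state s x, realizations s.+1 xi
                             & feas_proj s.+1 x xi x']]
  else [set init M].

Definition well_posed : Prop :=
  binary (init M) /\
  forall (t : nat) x xi, (1 <= t <= horizon M)%N ->
    feasible_state t.-1 x -> realizations t xi ->
    [/\ feas M t x xi !=set0,
        compact (feas M t x xi)
      & mixed_integer_polyhedral (integral_part M t) (feas M t x xi)].

Definition distribution : set 'cV[R]_K :=
  [set p | (forall k, 0 <= p k 0) /\ \sum_k p k 0 = 1].

(* [P t x] is the ambiguity set for the law of $\xi_t$ when the state at the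
   end of stage [t - 1] is [x]. *)
Section Value.
Variable P : nat -> 'cV[R]_I -> set 'cV[R]_K.

(* Value function of stage [t] when [n] stages come after it.  The extrema are
   real [inf] and [sup]: they are the minimum and the maximum as soon as these
   exist.  In particular [sup] is 0 on an empty ambiguity set, for which the
   maximum is meaningless. *)
Fixpoint value_rec (n t : nat) (x : 'cV[R]_I) (xi : 'cV[R]_J) : R :=
  if n is n'.+1 then
    inf [set (cost M t z : R) +
             sup [set \sum_k p k 0 * value_rec n' t.+1 z.1 (scenario M t.+1 k)
                 | p in P t.+1 z.1]
        | z in feas M t x xi]
  else inf [set (cost M t z : R) | z in feas M t x xi].

(* $Q_t(x_{t-1}, \xi_t)$ *)
Definition value (t : nat) : 'cV[R]_I -> 'cV[R]_J -> R :=
  value_rec (horizon M - t) t.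

Lemma value_last x xi :
  value (horizon M) x xi =
  inf [set (cost M (horizon M) z : R) | z in feas M (horizon M) x xi].
Proof. by rewrite /value subnn. Qed.

Lemma value_bellman t x xi : (t < horizon M)%N ->
  value t x xi =
  inf [set (cost M t z : R) +
           sup [set \sum_k p k 0 * value t.+1 z.1 (scenario M t.+1 k)
               | p in P t.+1 z.1]
      | z in feas M t x xi].
Proof. by move=> tT; rewrite /value subnS -(@prednK (horizon M - t)) ?subn_gt0. Qed.

End Value.

Section Type3.
(* [mu t x] and [Sigma t x] are the estimates of the mean and of the covariance
   of $\xi_t$ when the state at the end of stage [t - 1] is [x]. *)
Variables (mu : nat -> 'cV[R]_I -> 'cV[R]_J) (Sigma : nat -> 'cV[R]_I -> 'M[R]_J).

Definition scenario_dev (t : nat) (x : 'cV[R]_I) (k : 'I_K) : 'cV[R]_J :=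
  scenario M t k - mu t x.

Definition mean_dev (t : nat) (x : 'cV[R]_I) (p : 'cV[R]_K) : 'cV[R]_J :=
  \sum_k p k 0 *: scenario M t k - mu t x.

Definition mean_dist (t : nat) (x : 'cV[R]_I) (p : 'cV[R]_K) : R :=
  ((mean_dev t x p)^T *m invmx (Sigma t x) *m mean_dev t x p) 0 0.

Definition second_moment (t : nat) (x : 'cV[R]_I) (p : 'cV[R]_K) : 'M[R]_J :=
  \sum_k p k 0 *: (scenario_dev t x k *m (scenario_dev t x k)^T).

Definition type3 (gamma eta : R) (t : nat) (x : 'cV[R]_I) : set 'cV[R]_K :=
  [set p | [/\ distribution p, mean_dist t x p <= gamma
             & psd (eta *: Sigma t x - second_moment t x p)]].

Definition type3_strict (gamma eta : R) (t : nat) (x : 'cV[R]_I) : set 'cV[R]_K :=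
  [set p | [/\ distribution p, mean_dist t x p < gamma
             & posdef (eta *: Sigma t x - second_moment t x p)]].

End Type3.
End Problem.
End Model.

(* Main.v *)
Require Import Defs.
From HB Require Import structures.
From mathcomp Require Import all_boot all_order all_algebra.
From mathcomp Require Import all_classical all_reals all_analysis.
From mathcomp Require Import ring lra.

Set Implicit Arguments.
Unset Strict Implicit.
Unset Printing Implicit Defensive.

Import Order.TTheory GRing.Theory Num.Theory.
Import numFieldNormedType.Exports.

Local Open Scope classical_set_scope.
Local Open Scope ring_scope.

(** Fix a decision with state [x].  The inner problem maximizes the
    expectation of the next value function, a linear function of [p], over the
    probability simplex with two convex side constraints.  By a Schur complement
    the bound on the mean says that a bordered matrix, affine in [p], is
    semidefinite ([schur_psd]); the bound on the second moment already has this
    form.  Together they are one linear matrix inequality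
    [\sum_k p k 0 *: moment_lmi k] semidefinite, and the Slater point makes this
    matrix positive definite ([moment_lmi_posdef]).

    The multiplier of this inequality is a semidefinite matrix whose diagonal
    blocks are [Z] and [Y].  The multiplier [s] of the normalization then makes
    the dual program the one in the statement.  Weak duality is the
    nonnegativity of the trace product of two semidefinite matrices.  Strong
    duality, with an attained dual optimum, is [lmi_strong_duality]: minimize the
    total squared violation of the dual constraints over the semidefinite cone.
    Slater's condition makes the problem coercive, so that a minimizer exists; if
    constraints were violated there, the violations themselves, normalized, would
    be a distribution in the ambiguity set with a value above the supremum.

    So for each decision the inner supremum is the least dual value, and it
    remains to see that the outer infimum is attained.  The feasible set is
    compact, the cost is linear, and the inner supremum depends only on the binary
    state, so it is locally constant on the feasible set
    ([binary_state_attained]). *)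

(** * Semidefinite matrices *)

Definition bform (R : realType) n (A : 'M[R]_n) (u v : 'cV[R]_n) : R :=
  (u^T *m A *m v) 0 0.

Section SemidefiniteMatrices.
Variable R : realType.

Lemma bformDl n (A : 'M[R]_n) u v w :
  bform A (u + v) w = bform A u w + bform A v w.
Proof. by rewrite /bform linearD !mulmxDl mxE. Qed.

Lemma bformDr n (A : 'M[R]_n) u v w :
  bform A w (u + v) = bform A w u + bform A w v.
Proof. by rewrite /bform mulmxDr mxE. Qed.

Lemma bformZl n (A : 'M[R]_n) a u w : bform A (a *: u) w = a * bform A u w.
Proof. by rewrite /bform linearZ /= -!scalemxAl mxE. Qed.

Lemma bformZr n (A : 'M[R]_n) a u w : bform A w (a *: u) = a * bform A w u.
Proof. by rewrite /bform -scalemxAr mxE. Qed.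

Lemma bformC n (A : 'M[R]_n) u v : A^T = A -> bform A u v = bform A v u.
Proof.
move=> symA; rewrite /bform.
have -> : v^T *m A *m u = (u^T *m A *m v)^T by rewrite !trmx_mul trmxK symA mulmxA.
by rewrite [RHS]mxE.
Qed.

Lemma bformB n (A B : 'M[R]_n) u v :
  bform (A - B) u v = bform A u v - bform B u v.
Proof. by rewrite /bform mulmxBr mulmxBl mxE [X in _ + X]mxE. Qed.

Lemma bform_scale n (A : 'M[R]_n) a u v : bform (a *: A) u v = a * bform A u v.
Proof. by rewrite /bform -scalemxAr -scalemxAl mxE. Qed.

Lemma bform_delta n (A : 'M[R]_n) i j :
  bform A (delta_mx i 0) (delta_mx j 0) = A i j.
Proof. by rewrite /bform trmx_delta -rowE -colE !mxE. Qed.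

Lemma bform_rank1 n (c u v : 'cV[R]_n) :
  bform (c *m c^T) u v = (u^T *m c) 0 0 * (c^T *m v) 0 0.
Proof.
by rewrite /bform mulmxA -mulmxA [LHS]mxE big_ord1.
Qed.

Lemma frobE n (A B : 'M[R]_n) : frob A B = \sum_i \sum_j A i j * B i j.
Proof.
rewrite /frob /mxtrace exchange_big; apply: eq_bigr => i _.
by rewrite mxE; apply: eq_bigr => j _; rewrite mxE.
Qed.

Lemma frobC n (A B : 'M[R]_n) : frob A B = frob B A.
Proof. by rewrite !frobE; do 2!apply: eq_bigr => ? _; rewrite mulrC. Qed.

Lemma frobDl n (A B C : 'M[R]_n) : frob (A + B) C = frob A C + frob B C.
Proof. by rewrite /frob linearD mulmxDl linearD. Qed.

Lemma frobZl n a (A C : 'M[R]_n) : frob (a *: A) C = a * frob A C.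
Proof. by rewrite /frob linearZ -scalemxAl linearZ. Qed.

Lemma frobBl n (A B C : 'M[R]_n) : frob (A - B) C = frob A C - frob B C.
Proof. by rewrite frobDl -scaleN1r frobZl mulN1r. Qed.

Lemma frob_suml n (I : Type) (r : seq I) (A : I -> 'M[R]_n) C :
  frob (\sum_(i <- r) A i) C = \sum_(i <- r) frob (A i) C.
Proof. by rewrite /frob !linear_sum mulmx_suml linear_sum. Qed.

Lemma frob_rank1 n (A : 'M[R]_n) v : frob (v *m v^T) A = bform A v v.
Proof.
by rewrite /frob trmx_mul trmxK -mulmxA mxtrace_mulC trace_mx11.
Qed.

Lemma psd0 n : psd (0 : 'M[R]_n).
Proof. by split=> [|v]; rewrite ?trmx0// mulmx0 mul0mx mxE. Qed.

Lemma psdD n (A B : 'M[R]_n) : psd A -> psd B -> psd (A + B).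
Proof.
move=> [sA pA] [sB pB]; split=> [|v]; first by rewrite linearD /= sA sB.
by rewrite mulmxDr mulmxDl mxE addr_ge0.
Qed.

Lemma psdZ n a (A : 'M[R]_n) : 0 <= a -> psd A -> psd (a *: A).
Proof.
move=> a0 [sA pA]; split=> [|v]; first by rewrite linearZ /= sA.
by rewrite -scalemxAr -scalemxAl mxE mulr_ge0.
Qed.

Lemma psd_rank1 n (v : 'cV[R]_n) : psd (v *m v^T).
Proof.
split=> [|u]; first by rewrite trmx_mul trmxK.
rewrite -/(bform _ _ _) bform_rank1.
have -> : (u^T *m v) 0 0 = (v^T *m u) 0 0.
  by rewrite -[in RHS](trmxK u) -trmx_mul [RHS]mxE.
by rewrite -expr2 sqr_ge0.
Qed.

Lemma posdef_psd n (A : 'M[R]_n) : posdef A -> psd A.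
Proof.
move=> [sA pA]; split=> // v; have [->|v0] := eqVneq v 0.
  by rewrite mulmx0 mxE.
exact/ltW/pA.
Qed.

(** A semidefinite form may have null vectors, so the usual division by [bform
    A v v] is not always possible; the quadratic polynomial [bform A (a *:
    u + b *: v) (a *: u + b *: v)] is therefore tested at a point that
    depends on whether that coefficient vanishes. *)
Lemma psd_cauchy_schwarz n (A : 'M[R]_n) u v : psd A ->
  bform A u v ^+ 2 <= bform A u u * bform A v v.
Proof.
move=> [sA pA].
have quad a b : 0 <= a ^+ 2 * bform A u u + 2 * (a * b) * bform A u v
                    + b ^+ 2 * bform A v v.
  have := pA (a *: u + b *: v); rewrite -/(bform _ _ _).
  rewrite !(bformDl, bformDr, bformZl, bformZr) (bformC v u sA).
  by congr (_ <= _); ring.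
move: (quad) (pA u) (pA v); rewrite -!/(bform _ _ _).
move: (bform A u u) (bform A u v) (bform A v v) => a b c {}quad a0 c0.
have [c_eq0|cneq0] := eqVneq c 0.
  (* along a null direction of A the quadratic polynomial is affine *)
  have [->|b0] := eqVneq b 0; first by rewrite c_eq0 mulr0 expr0n.
  have := quad 1 (- (a + 1) / (2 * b)).
  suff -> : 1 ^+ 2 * a + 2 * (1 * (- (a + 1) / (2 * b))) * b
     + (- (a + 1) / (2 * b)) ^+ 2 * c = - 1 by rewrite lerNr oppr0 ler10.
  by rewrite c_eq0; field.
have cp : 0 < c by rewrite lt_def cneq0.
have := quad c (- b).
have -> : c ^+ 2 * a + 2 * (c * - b) * b + (- b) ^+ 2 * c = c * (a * c - b ^+ 2).
  by ring.
by rewrite pmulr_rge0// subr_ge0.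
Qed.

Lemma psd_entry n (A : 'M[R]_n) i j : psd A -> A i j ^+ 2 <= A i i * A j j.
Proof.
move=> pA; have := psd_cauchy_schwarz (delta_mx i 0) (delta_mx j 0) pA.
by rewrite !bform_delta.
Qed.

Lemma psd_diag_ge0 n (A : 'M[R]_n) i : psd A -> 0 <= A i i.
Proof. by move=> [_ pA]; rewrite -bform_delta; apply: pA. Qed.

(** The trace bounds every entry of a semidefinite matrix: this is how a bound
    on one linear functional gives compactness. *)
Lemma psd_entry_le_trace n (A : 'M[R]_n) i j : psd A -> `|A i j| <= \tr A.
Proof.
move=> pA; have diag0 k := psd_diag_ge0 k pA.
have le_tr k : A k k <= \tr A.
  by rewrite /mxtrace (bigD1 k)//= lerDl sumr_ge0.
rewrite -(@ler_pXn2r _ 2) ?nnegrE//; last exact: le_trans (le_tr i).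
by rewrite real_normK ?num_real// (le_trans (psd_entry i j pA))// expr2 ler_pM.
Qed.

(** Cholesky factorization, which stands in for the spectral theorem.
    Subtracting [w *m w^T] with [w] the column of a nonzero pivot, divided
    by the square root of the pivot, leaves a semidefinite matrix by the
    Cauchy-Schwarz inequality and clears one more diagonal entry. The
    matrix that is left when no pivot remains is 0, because a semidefinite
    matrix with zero diagonal is. *)
Lemma psd_sum_rank1 n (A : 'M[R]_n) : psd A ->
  exists s : seq 'cV[R]_n, A = \sum_(v <- s) v *m v^T.
Proof.
have [m] := ubnP #|[pred i | A i i != 0]|.
elim: m A => // m IHm A; rewrite ltnS => Am pA.
have [i Ai|diag0] := pickP (fun i => A i i != 0); last first.
  exists [::]; rewrite big_nil; apply/matrixP => i j; rewrite mxE.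
  have := psd_entry i j pA.
  move/negbFE/eqP: (diag0 i) => ->; rewrite mul0r => A2.
  by apply/eqP; rewrite -sqrf_eq0 eq_le A2 sqr_ge0.
have Ai0 : 0 < A i i by rewrite lt_def Ai psd_diag_ge0.
pose w : 'cV[R]_n := (Num.sqrt (A i i))^-1 *: (A *m delta_mx i 0).
pose Ae : 'cV[R]_n := A *m delta_mx i 0.
have wwE : w *m w^T = (A i i)^-1 *: (Ae *m Ae^T).
  rewrite /w linearZ /= -scalemxAl -scalemxAr scalerA -invfM -expr2 sqr_sqrtr//.
  exact: ltW.
have AwwE u v : bform (A - w *m w^T) u v
    = bform A u v
      - (A i i)^-1 * (bform A u (delta_mx i 0) * bform A (delta_mx i 0) v).
  rewrite bformB wwE bform_scale bform_rank1 /Ae /bform -!mulmxA.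
  by rewrite trmx_mul (proj1 pA) -!mulmxA.
have AwwE' j k : (A - w *m w^T) j k = A j k - (A i i)^-1 * (A j i * A i k).
  by rewrite -[LHS]bform_delta AwwE !bform_delta.
have pAww : psd (A - w *m w^T).
  split; first by rewrite linearB /= trmx_mul trmxK (proj1 pA).
  move=> v; rewrite -/(bform _ _ _) AwwE (bformC _ _ (proj1 pA)) -expr2.
  rewrite subr_ge0 mulrC ler_pdivrMr// mulrC -[A i i]bform_delta.
  exact: psd_cauchy_schwarz.
have [|s sE] := IHm _ _ pAww; last first.
  by exists (w :: s); rewrite big_cons -sE addrC subrK.
(* the diagonal entry of the pivot vanishes and no zero entry is lost *)
apply: leq_trans Am; apply: proper_card; apply/properP; split.
  apply/fintype.subsetP => j; rewrite !inE; apply: contra => /eqP Aj.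
  have := psd_entry j i pA; rewrite Aj mul0r => A2.
  have Aji : A j i = 0 by apply/eqP; rewrite -sqrf_eq0 eq_le A2 sqr_ge0.
  by rewrite AwwE' Aji Aj mul0r mulr0 subr0.
exists i; first by rewrite inE.
by rewrite inE AwwE' mulrA mulVf// mul1r subrr eqxx.
Qed.

(** Half of the self-duality of the semidefinite cone, and the inequality
    behind weak duality. *)
Lemma frob_psd_ge0 n (A B : 'M[R]_n) : psd A -> psd B -> 0 <= frob A B.
Proof.
move=> /psd_sum_rank1[s ->] [_ pB]; rewrite frob_suml sumr_ge0// => v _.
by rewrite frob_rank1; apply: pB.
Qed.

Lemma posdef_unitmx n (A : 'M[R]_n) : posdef A -> A \in unitmx.
Proof.
move=> [sA pA]; rewrite unitmxE unitfE; apply/det0P => -[v v0 vA].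
have /pA : v^T != 0 by rewrite -[0]trmx0 (inj_eq trmx_inj).
by rewrite trmxK vA mul0mx mxE ltxx.
Qed.

(** The Cauchy-Schwarz inequality for [G], applied to [v] and to the i-th
    column of the inverse of [G], bounds the square of [v i] by a multiple
    of [bform G v v]; summed over [i] and over a decomposition of [W] into
    squares, this makes the trace of [invmx G] a possible constant. *)
Lemma posdef_coercive n (G : 'M[R]_n) : posdef G ->
  exists2 C, 0 <= C & forall W, psd W -> \tr W <= C * frob W G.
Proof.
move=> pG; have [_ nG] := posdef_psd pG.
pose e i := invmx G *m delta_mx i 0 : 'cV[R]_n.
exists (\sum_i bform G (e i) (e i)) => [|W /psd_sum_rank1[s ->]].
  by apply: sumr_ge0 => i _; apply: nG.
rewrite frob_suml mulr_sumr raddf_sum /= ler_sum// => v _.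
rewrite frob_rank1 mulr_suml /mxtrace ler_sum// => i _.
have -> : (v *m v^T) i i = bform G v (e i) ^+ 2.
  rewrite /bform /e -mulmxA (mulmxA G) mulmxV ?posdef_unitmx// mul1mx.
  by rewrite -colE !mxE big_ord1 !mxE -expr2.
by rewrite mulrC; apply: psd_cauchy_schwarz; apply: posdef_psd.
Qed.

End SemidefiniteMatrices.

(** * Duality for linear matrix inequalities over a simplex *)

Section Duality.
Variable R : realType.

Lemma sum_coord_continuous m n (c : 'I_m -> 'I_n -> R) :
  continuous (fun A : 'M[R]_(m, n) => \sum_i \sum_j c i j * A i j).
Proof.
apply: continuous_big => [|i _]; first exact: add_continuous.
apply: continuous_big => [|j _]; first exact: add_continuous.
move=> A; apply: (@continuousM _ _ (fun=> c i j) (fun A : 'M[R]_(m, n) => A i j)).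
  exact: cst_continuous.
exact: coord_continuous.
Qed.

Lemma frob_continuous n (A : 'M[R]_n) : continuous (frob A).
Proof.
rewrite (_ : frob A = fun B => \sum_i \sum_j A i j * B i j).
  exact: sum_coord_continuous.
by apply/funext => B; rewrite frobE.
Qed.

Lemma psd_closed n : closed [set A : 'M[R]_n | psd A].
Proof.
rewrite (_ : mkset _ =
    \bigcap_(ij in [set: 'I_n * 'I_n])
      [set A : 'M[R]_n | A ij.1 ij.2 - A ij.2 ij.1 = 0] `&`
    \bigcap_(v in [set: 'cV[R]_n])
      [set A : 'M[R]_n | 0 <= frob (v *m v^T) A]).
  apply: closedI; [apply: closed_bigI => ij _|apply: closed_bigI => v _].
    have /continuous_closedP cl :
        continuous (fun A : 'M[R]_n => A ij.1 ij.2 - A ij.2 ij.1).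
      by move=> A; apply: (@continuousB _ _ _ (fun A : 'M[R]_n => A ij.1 ij.2)
        (fun A : 'M[R]_n => A ij.2 ij.1)); exact: coord_continuous.
    exact: cl _ (@closed_eq R 0).
  have /continuous_closedP cl := @frob_continuous _ (v *m v^T).
  exact: cl _ (@closed_ge R 0).
apply/seteqP; split=> A /=.
  move=> [sA pA]; split=> [[i j] _|v _] /=.
    by rewrite -{1}sA mxE subrr.
  by rewrite frob_rank1; apply: pA.
move=> [sA pA]; split.
  by apply/matrixP => i j; rewrite mxE; apply/eqP; rewrite -subr_eq0 (sA (j, i)).
by move=> v; have := pA v I; rewrite /= frob_rank1.
Qed.

(** A box of matrices is the image, under the continuous map [vec_mx], of a
    box of row vectors, which is compact as a finite product of segments. *)
Lemma mx_box_compact m n (c : R) :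
  compact [set A : 'M[R]_(m, n) | forall i j, `|A i j| <= c].
Proof.
rewrite (_ : mkset _ = vec_mx @`
    [set u : 'rV[R]_(m * n) | forall i, `[- c, c]%classic (u ord0 i)]).
  apply: continuous_compact; last first.
    exact: (@rV_compact _ _ (fun=> `[- c, c]%classic)
      (fun=> @segment_compact _ _ _)).
  apply: continuous_subspaceT => u s /nbhs_ballP[e e0 es].
  apply/nbhs_ballP; exists e => //= w [_ uw]; apply: es; split=> // i j.
  by rewrite !mxE; apply: uw.
apply/seteqP; split=> A /=.
  move=> Ac; exists (mxvec A); last exact: mxvecK.
  by move=> k; case/mxvec_indexP: k => i j; rewrite mxvecE /= in_itv /= -ler_norml.
move=> [u uc <-] i j; rewrite mxE ler_norml.
by have := uc (mxvec_index i j); rewrite /= in_itv.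
Qed.

Lemma psd_trace_compact n (c : R) :
  compact [set A : 'M[R]_n | psd A /\ \tr A <= c].
Proof.
apply: subclosed_compact (mx_box_compact (c := c)) _; last first.
  by move=> A [pA trA] i j; apply: le_trans trA; apply: psd_entry_le_trace.
rewrite (_ : mkset _ = [set A : 'M[R]_n | psd A] `&`
                       [set A : 'M[R]_n | frob 1%:M A <= c]).
  apply: closedI; first exact: psd_closed.
  have /continuous_closedP cl := @frob_continuous n 1%:M.
  exact: cl _ (@closed_le R c).
by apply/seteqP; split=> A /=; rewrite /frob trmx1 mul1mx.
Qed.

(** First-order optimality condition for the sum of the squared positive
    parts, without derivatives: the positive part of [a + r * b] is at
    most the absolute value of [(positive part of a) + r * b], so the
    growth of the sum along [b] is at most a quadratic polynomial in [r]
    without constant term, whose linear coefficient must be nonnegative. *)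
Lemma pos_part_sq_stationary K (a b : 'I_K -> R) :
  (forall r, 0 <= r -> r <= 1 -> \sum_k Num.max 0 (a k) ^+ 2
                                 <= \sum_k Num.max 0 (a k + r * b k) ^+ 2) ->
  0 <= \sum_k Num.max 0 (a k) * b k.
Proof.
move=> amin; set L := \sum_k _; pose B := \sum_k b k ^+ 2.
have B0 : 0 <= B by apply: sumr_ge0 => k _; apply: sqr_ge0.
have quad r : 0 <= r -> r <= 1 -> 0 <= r * (2 * L + r * B).
  move=> r0 r1; have := amin r r0 r1.
  have -> : r * (2 * L + r * B) = \sum_k (Num.max 0 (a k) + r * b k) ^+ 2
                                  - \sum_k Num.max 0 (a k) ^+ 2.
    rewrite /L /B !mulr_sumr -big_split /= mulr_sumr -sumrB.
    by apply: eq_bigr => k _; ring.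
  rewrite subr_ge0 => /le_trans; apply; apply: ler_sum => k _.
  case: (leP 0 (a k + r * b k)) => [ab0|_]; last by rewrite expr0n sqr_ge0.
  by rewrite ler_pXn2r ?nnegrE// ?lerD2r ?(le_trans ab0)// ?lerD2r le_max lexx orbT.
rewrite leNgt; apply/negP => L0.
have BL : 0 < B - L by rewrite subr_gt0 (lt_le_trans L0).
(* small enough for the linear term to dominate; [B - L] keeps it below 1 *)
pose r := - L / (B - L).
have r0 : 0 < r by rewrite divr_gt0// oppr_gt0.
have r1 : r <= 1 by rewrite ler_pdivrMr// mul1r lerDr.
have := quad r (ltW r0) r1; rewrite pmulr_rge0// => LB.
have rB : r * B = - L - r * (- L) by rewrite /r; field; rewrite gt_eqF.
have : 0 < r * - L by rewrite mulr_gt0// oppr_gt0.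
lra.
Qed.

(** Strong duality, with an attained dual optimum, for the maximization of a
    linear function over the distributions [p] with [\sum_k p k 0 *: G k]
    semidefinite. Let [a W k] be the amount by which [W] violates the k-th
    dual constraint, and minimize over the semidefinite cone the sum of
    the squares of the positive parts of [a W k]. The Slater point [p0]
    averages the constraints into a bound on the trace of [W], so sublevel
    sets are compact and a minimizer [W] exists. If it violates some
    constraint, the positive parts [w k] of [a W k], normalized, form a
    distribution. Optimality in the directions of the cone makes it
    satisfy the matrix inequality; optimality in the direction [- W] gives
    [\sum_k w k * frob (G k) W <= 0], so its value exceeds [v] by at least
    [(\sum_k w k ^+ 2) / \sum_k w k]. This contradicts the bound [v]. *)
Lemma lmi_strong_duality n K (G : 'I_K -> 'M[R]_n) (q : 'I_K -> R)
    (p0 : 'cV[R]_K) (v : R) :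
  (forall k, (G k)^T = G k) -> Defs.distribution p0 ->
  posdef (\sum_k p0 k 0 *: G k) ->
  (forall p : 'cV[R]_K, Defs.distribution p -> psd (\sum_k p k 0 *: G k) ->
    \sum_k p k 0 * q k <= v) ->
  exists W, psd W /\ forall k, q k + frob (G k) W <= v.
Proof.
move=> symG [p0_ge0 p0_sum] G0 vub.
pose a W k := q k + frob (G k) W - v.
pose h W := \sum_k Num.max 0 (a W k) ^+ 2.
have h_cont : continuous h.
  apply: continuous_big => [|k _]; first exact: add_continuous.
  have pos_cont : continuous (fun W => Num.max 0 (a W k)).
    move=> W; apply: (@continuous_max _ _ (cst 0) (a^~ k)).
      exact: cst_continuous.
    apply: (@continuousB _ _ _ (fun W => q k + frob (G k) W) (cst v));
      last exact: cst_continuous.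
    apply: (@continuousD _ _ _ (cst (q k)) (frob (G k))).
      exact: cst_continuous.
    exact: frob_continuous.
  move=> W; exact: (@continuousM _ _ _ _ W (pos_cont W) (pos_cont W)).
have [C C0 coer] := posdef_coercive G0.
pose c := C * (h 0 + 1 + v - \sum_k p0 k 0 * q k).
have sublevel W : psd W -> h W <= h 0 -> \tr W <= c.
  move=> pW hW; apply: le_trans (coer W pW) _; apply: ler_wpM2l => //.
  rewrite frobC frob_suml.
  have : \sum_k p0 k 0 * a W k <= h 0 + 1.
    rewrite -[leRHS]mul1r -p0_sum mulr_suml; apply: ler_sum => k _.
    apply: ler_wpM2l => //; have : Num.max 0 (a W k) ^+ 2 <= h 0.
      apply: le_trans hW; rewrite /h (bigD1 k)//= lerDl.
      by apply: sumr_ge0 => i _; apply: sqr_ge0.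
    have : a W k <= Num.max 0 (a W k) by rewrite le_max lexx orbT.
    move: (Num.max _ _) => x ax xh; nra.
  have -> : \sum_k p0 k 0 * a W k = \sum_k p0 k 0 * q k
      + \sum_k frob (p0 k 0 *: G k) W - v.
    rewrite -[v in RHS]mul1r -p0_sum mulr_suml -big_split /= -sumrB.
    by apply: eq_bigr => k _; rewrite frobZl /a; ring.
  lra.
have S0 : [set W : 'M[R]_n | psd W /\ \tr W <= c] !=set0.
  by exists 0; split; [exact: psd0 | apply: sublevel => //; exact: psd0].
have [W] :=
  compact_EVT_min S0 (@psd_trace_compact n c) (continuous_subspaceT h_cont).
rewrite inE => -[pW trW] Wmin.
have {}Wmin U : psd U -> h W <= h U.
  move=> pU; have [hU|/ltW h0U] := leP (h U) (h 0).
    by apply: Wmin; rewrite inE; split=> //; apply: sublevel.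
  apply: le_trans h0U; apply: Wmin; rewrite inE.
  by split; [exact: psd0 | apply: sublevel => //; exact: psd0].
pose w k := Num.max 0 (a W k).
have w0 k : 0 <= w k by rewrite le_max lexx.
(* moving from the minimizer along a direction that stays in the cone *)
have stationary U : (forall r, 0 <= r -> r <= 1 -> psd (W + r *: U)) ->
    0 <= \sum_k w k * frob (G k) U.
  move=> WU; apply: pos_part_sq_stationary => r r0 r1.
  rewrite (le_trans (Wmin _ (WU r r0 r1)))//.
  apply: ler_sum => k _; rewrite /a frobC frobDl frobZl !(frobC _ (G k)).
  by rewrite addrAC !addrA (addrAC _ (- v)).
have w_cone U : psd U -> 0 <= \sum_k w k * frob (G k) U.
  by move=> pU; apply: stationary => r r0 _; apply: psdD => //; apply: psdZ.
have w_W : \sum_k w k * frob (G k) W <= 0.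
  have : 0 <= \sum_k w k * frob (G k) (- W).
    apply: stationary => r _ r1; rewrite scalerN -{1}[W]scale1r -scalerBl.
    by apply: psdZ; rewrite // subr_ge0.
  have -> : \sum_k w k * frob (G k) (- W) = - \sum_k w k * frob (G k) W.
    rewrite -sumrN; apply: eq_bigr => k _.
    by rewrite frobC -scaleN1r frobZl mulN1r mulrN frobC.
  by rewrite oppr_ge0.
exists W; split=> // k; rewrite leNgt; apply/negP => vk.
have wk : 0 < w k by rewrite lt_max subr_gt0 vk orbT.
pose sw := \sum_k w k.
have sw0 : 0 < sw.
  by rewrite /sw (bigD1 k)//= ltr_pwDl// sumr_ge0.
pose p : 'cV[R]_K := \col_k (w k / sw).
have pE (x : 'I_K -> R) : \sum_k p k 0 * x k = (\sum_k w k * x k) / sw.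
  by rewrite mulr_suml; apply: eq_bigr => i _; rewrite mxE mulrAC.
have dp : Defs.distribution p.
  split=> [i|]; first by rewrite mxE divr_ge0// ltW.
  have := pE (fun=> 1); under eq_bigr do rewrite mulr1.
  by under [X in _ = X / _]eq_bigr do rewrite mulr1; rewrite divff ?gt_eqF.
have pG : psd (\sum_k p k 0 *: G k).
  split=> [|u].
    by rewrite linear_sum; apply: eq_bigr => i _; rewrite linearZ /= symG.
  rewrite -/(bform _ _ _) -frob_rank1 frobC frob_suml.
  under eq_bigr do rewrite frobZl.
  by rewrite pE divr_ge0 ?(ltW sw0)//; apply: w_cone; apply: psd_rank1.
have := vub p dp pG; rewrite pE ler_pdivrMr// leNgt => /negP; apply.
(* the weights vanish outside the violated constraints *)
have wa : \sum_i w i * a W i = \sum_i w i ^+ 2.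
  apply: eq_bigr => i _; rewrite /w.
  by case: (leP 0 (a W i)) => _; rewrite ?mul0r ?expr0n.
have : 0 < \sum_i w i ^+ 2.
  by rewrite (bigD1 k)//= ltr_pwDl ?exprn_gt0// sumr_ge0// => i _; apply: sqr_ge0.
rewrite -wa.
have -> : \sum_i w i * a W i
    = \sum_i w i * q i + \sum_i w i * frob (G i) W - v * sw.
  by rewrite mulr_sumr -big_split /= -sumrB; apply: eq_bigr => i _; rewrite /a; ring.
lra.
Qed.

End Duality.

(** * Block matrices and Schur complements *)

Section BlockMatrices.
Variable R : realType.

Lemma frob_block n1 n2 (A A' : 'M[R]_n1) (B B' : 'M[R]_(n1, n2))
    (C C' : 'M[R]_(n2, n1)) (D D' : 'M[R]_n2) :
  frob (block_mx A B C D) (block_mx A' B' C' D')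
  = frob A A' + \tr (B^T *m B') + \tr (C^T *m C') + frob D D'.
Proof.
rewrite /frob tr_block_mx mulmx_block mxtrace_block !linearD /=; ring.
Qed.

Lemma bform_block_diag n1 n2 (A : 'M[R]_n1) (B : 'M[R]_n2) u v :
  bform (block_mx A 0 0 B) u v =
  bform A (usubmx u) (usubmx v) + bform B (dsubmx u) (dsubmx v).
Proof.
rewrite /bform -{1}[u]vsubmxK -{1}[v]vsubmxK tr_col_mx mul_row_block mul_row_col.
by rewrite !mulmx0 addr0 add0r mxE.
Qed.

Lemma psd_block_diag n1 n2 (A : 'M[R]_n1) (B : 'M[R]_n2) :
  psd (block_mx A 0 0 B) <-> psd A /\ psd B.
Proof.
split=> [[sW pW]|[[sA pA] [sB pB]]].
  move: sW; rewrite tr_block_mx !trmx0 => /eq_block_mx[sA _ _ sB].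
  split; split=> // v.
    have := pW (col_mx v 0); rewrite -/(bform _ _ _) bform_block_diag.
    by rewrite col_mxKu col_mxKd /bform !mulmx0 [X in _ + X]mxE addr0.
  have := pW (col_mx 0 v); rewrite -/(bform _ _ _) bform_block_diag.
  by rewrite col_mxKu col_mxKd /bform !mulmx0 [X in X + _]mxE add0r.
split=> [|v]; first by rewrite tr_block_mx !trmx0 sA sB.
by rewrite -/(bform _ _ _) bform_block_diag addr_ge0//; [apply: pA | apply: pB].
Qed.

Lemma posdef_block_diag n1 n2 (A : 'M[R]_n1) (B : 'M[R]_n2) :
  posdef A -> posdef B -> posdef (block_mx A 0 0 B).
Proof.
move=> pA pB; have [sA dA] := pA; have [sB dB] := pB.
have [_ nA] := posdef_psd pA; have [_ nB] := posdef_psd pB.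
split=> [|v v0]; first by rewrite tr_block_mx !trmx0 sA sB.
rewrite -/(bform _ _ _) bform_block_diag.
have [u0|u0] := eqVneq (usubmx v) 0; last first.
  by rewrite ltr_pwDl//; [apply: dA | apply: nB].
rewrite ltr_wpDl//; [exact: nA | apply: dB].
by apply: contra_neq v0 => d0; rewrite -[v]vsubmxK u0 d0 col_mx0.
Qed.

Lemma psd_submx n1 n2 (W : 'M[R]_(n1 + n2)) : psd W ->
  [/\ psd (ulsubmx W), psd (drsubmx W) & dlsubmx W = (ursubmx W)^T].
Proof.
move=> [sW pW].
have := sW; rewrite -{1 2}[W]submxK tr_block_mx => /eq_block_mx[sA sC _ sB].
split; [split=> // v | split=> // v | by rewrite -sC trmxK].
  have := pW (col_mx v 0); rewrite -{1}[W]submxK tr_col_mx mul_row_block.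
  by rewrite mul_row_col trmx0 !mulmx0 !mul0mx !addr0.
have := pW (col_mx 0 v); rewrite -{1}[W]submxK tr_col_mx mul_row_block.
by rewrite mul_row_col trmx0 !mulmx0 !mul0mx !add0r.
Qed.

Section Schur.
Variables (n : nat) (S : 'M[R]_n) (m : 'cV[R]_n) (gamma : R).
Hypothesis Spd : posdef S.

(** Completing the square: the coefficient left for the last coordinate is the
    Schur complement. *)
Lemma bform_schur (v : 'cV[R]_(n + 1)) :
  let w := usubmx v + v (rshift n 0) 0 *: (invmx S *m m) in
  bform (block_mx S m m^T gamma%:M) v v
  = bform S w w + (gamma - (m^T *m invmx S *m m) 0 0) * v (rshift n 0) 0 ^+ 2.
Proof.
move=> w; have [sS _] := Spd.
rewrite {}/w.
have -> : v (rshift n 0) 0 = dsubmx v 0 0 by rewrite mxE.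
have Sw u : bform S u (invmx S *m m) = (u^T *m m) 0 0.
  by rewrite /bform -mulmxA (mulmxA S) mulmxV ?posdef_unitmx// mul1mx.
have trC (a b : 'cV[R]_n) : (a^T *m b) 0 0 = (b^T *m a) 0 0.
  by rewrite -[in RHS](trmxK a) -trmx_mul [RHS]mxE.
rewrite !(bformDl, bformDr, bformZl, bformZr).
rewrite (bformC (invmx S *m m) (usubmx v) sS) !Sw.
rewrite (trC (invmx S *m m)) mulmxA.
rewrite {1}/bform -{1 2}[v]vsubmxK tr_col_mx mul_row_block mul_row_col.
rewrite {1 2 3}[dsubmx v]mx11_scalar tr_scalar_mx !mul_scalar_mx !mul_mx_scalar.
move: (dsubmx v 0 0) (usubmx v) => k u.
have addE (A B : 'M[R]_1) : (A + B) 0 0 = A 0 0 + B 0 0 by rewrite mxE.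
have scaleE a (A : 'M[R]_1) : (a *: A) 0 0 = a * A 0 0 by rewrite mxE.
rewrite mulmxDl -scalemxAl !(addE, scaleE) (trC m u) [gamma%:M _ _]mxE mulr1n.
rewrite /bform; ring.
Qed.

Lemma schur_psd :
  (m^T *m invmx S *m m) 0 0 <= gamma <-> psd (block_mx S m m^T gamma%:M).
Proof.
have [sS pS] := posdef_psd Spd; split=> [le_gamma|[_ pZ]].
  split=> [|v]; first by rewrite tr_block_mx trmxK tr_scalar_mx sS.
  rewrite -/(bform _ _ _) bform_schur addr_ge0//; first exact: pS.
  by rewrite mulr_ge0 ?sqr_ge0// subr_ge0.
have := pZ (col_mx (- (invmx S *m m)) 1%:M).
rewrite -/(bform _ _ _) bform_schur col_mxKu col_mxEd !mxE eqxx.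
by rewrite scale1r addNr expr1n mulr1 /bform mulmx0 mxE add0r subr_ge0.
Qed.

Lemma schur_posdef :
  (m^T *m invmx S *m m) 0 0 < gamma -> posdef (block_mx S m m^T gamma%:M).
Proof.
have [sS pS] := posdef_psd Spd; have [_ dS] := Spd => lt_gamma.
split=> [|v v0]; first by rewrite tr_block_mx trmxK tr_scalar_mx sS.
rewrite -/(bform _ _ _) bform_schur.
have [k0|k0] := eqVneq (v (rshift n 0) 0) 0.
  rewrite k0 scale0r addr0 expr0n mulr0 addr0; apply: dS.
  apply: contra_neq v0 => u0; rewrite -[v]vsubmxK u0 [dsubmx v]mx11_scalar mxE k0.
  by rewrite raddf0 col_mx0.
rewrite ltr_wpDl//; first exact: pS.
by rewrite mulr_gt0 ?subr_gt0// exprn_even_gt0.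
Qed.

End Schur.
End BlockMatrices.

(** * Duality for the moment ambiguity set *)

Section Type3Duality.
Variables (R : realType) (I J K : nat) (M : problem R I J K).
Variables (mu : nat -> 'cV[R]_I -> 'cV[R]_J) (Sigma : nat -> 'cV[R]_I -> 'M[R]_J).
Variables (gamma eta : R) (t : nat) (x : 'cV[R]_I).
Hypothesis Sigma_posdef : posdef (Sigma t x).

Let m := mu t x.
Let S := Sigma t x.
Let xi k := scenario M t k.

(** The two moment constraints as one linear matrix inequality: the mean
    constraint is a Schur complement, and since the weights of a
    distribution sum to 1 the constant terms can be shared among the
    scenarios. *)
Definition moment_lmi (k : 'I_K) : 'M[R]_(J + 1 + J) :=
  block_mx (block_mx S (xi k - m) (xi k - m)^T gamma%:M) 0
           0 (eta *: S - (xi k - m) *m (xi k - m)^T).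

Lemma moment_lmi_sym k : (moment_lmi k)^T = moment_lmi k.
Proof.
have [sS _] := Sigma_posdef.
rewrite /moment_lmi !tr_block_mx trmxK !trmx0 tr_scalar_mx [S^T]sS.
by rewrite [(eta *: S - _)^T]linearB /= linearZ /= trmx_mul trmxK [S^T]sS.
Qed.

Lemma moment_lmi_mean (p : 'cV[R]_K) : \sum_k p k 0 = 1 ->
  \sum_k p k 0 *: moment_lmi k =
  block_mx (block_mx S (mean_dev M mu t x p) (mean_dev M mu t x p)^T gamma%:M) 0
           0 (eta *: S - second_moment M mu t x p).
Proof.
move=> p1.
have block_sum n1 n2 (F : 'I_K -> 'M[R]_n1) B C (D : 'I_K -> 'M[R]_n2) :
    \sum_k p k 0 *: block_mx (F k) (B k) (C k) (D k) =
    block_mx (\sum_k p k 0 *: F k) (\sum_k p k 0 *: B k)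
             (\sum_k p k 0 *: C k) (\sum_k p k 0 *: D k).
  under eq_bigr do rewrite scale_block_mx.
  elim: (index_enum _) => [|k r IHr]; last by rewrite !big_cons IHr add_block_mx.
  by rewrite !big_nil block_mx0.
have const n1 n2 (A : 'M[R]_(n1, n2)) : \sum_k p k 0 *: A = A.
  by rewrite -scaler_suml p1 scale1r.
have mean : \sum_k p k 0 *: (xi k - m) = mean_dev M mu t x p.
  by under eq_bigr do rewrite scalerBr; rewrite sumrB const.
rewrite /moment_lmi !block_sum !const mean; congr (block_mx (block_mx _ _ _ _) _ _ _).
  by rewrite -mean linear_sum; apply: eq_bigr => k _; rewrite linearZ.
by under eq_bigr do rewrite scalerBr; rewrite sumrB const.
Qed.

Lemma moment_lmi_psd (p : 'cV[R]_K) : Defs.distribution p ->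
  psd (\sum_k p k 0 *: moment_lmi k) <-> type3 M mu Sigma gamma eta t x p.
Proof.
move=> dp; rewrite moment_lmi_mean ?dp.2// psd_block_diag -schur_psd//.
by split=> [[]|[]].
Qed.

Lemma moment_lmi_posdef (p : 'cV[R]_K) :
  type3_strict M mu Sigma gamma eta t x p ->
  posdef (\sum_k p k 0 *: moment_lmi k).
Proof.
move=> [[_ p1] lt_gamma pd]; rewrite moment_lmi_mean//.
by apply: posdef_block_diag => //; apply: schur_posdef.
Qed.

Definition dual_constraint (q : 'I_K -> R) (s : R) (z2 : 'cV[R]_J)
    (Y : 'M[R]_J) :=
  forall k, s - 2 * (z2^T *m xi k) 0 0 + frob ((xi k - m) *m (xi k - m)^T) Y >= q k.

Definition dual_value (s : R) (z1 : 'M[R]_J) (z2 : 'cV[R]_J) (z3 : R)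
    (Y : 'M[R]_J) :=
  s + frob S z1 - 2 * (m^T *m z2) 0 0 + gamma * z3 + eta * frob S Y.

(** The dual constraint of scenario [k], for the multipliers gathered in one
    block matrix. Its off-diagonal blocks [B] and [C] are arbitrary
    because those of [moment_lmi k] vanish. *)
Lemma moment_lmi_slack s z1 (z2 : 'cV[R]_J) z3 Y B C k :
  s - 2 * (z2^T *m xi k) 0 0 + frob ((xi k - m) *m (xi k - m)^T) Y =
  dual_value s z1 z2 z3 Y
  - frob (moment_lmi k) (block_mx (block_mx z1 z2 z2^T z3%:M) B C Y).
Proof.
rewrite /dual_value /moment_lmi !frob_block !trmx0 !mul0mx !mxtrace0 !addr0.
have -> : \tr ((xi k - m)^T *m z2) = (z2^T *m xi k) 0 0 - (m^T *m z2) 0 0.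
  rewrite trace_mx11 linearB /= mulmxBl [LHS]mxE [X in _ + X]mxE; congr (_ - _).
  by rewrite -[in RHS](trmxK (xi k)) -trmx_mul [RHS]mxE.
have -> : \tr ((xi k - m)^T^T *m z2^T) = (z2^T *m xi k) 0 0 - (m^T *m z2) 0 0.
  rewrite mxtrace_mulC trmxK trace_mx11 mulmxBr [LHS]mxE [X in _ + X]mxE; congr (_ - _).
  by rewrite -[in RHS](trmxK z2) -trmx_mul [RHS]mxE.
have -> : frob (gamma%:M : 'M[R]_1) z3%:M = gamma * z3.
  by rewrite frobE !big_ord1 !mxE !mulr1n.
by rewrite frobBl frobZl; ring.
Qed.

Lemma type3_weak_duality (q : 'I_K -> R) s z1 z2 z3 Y p :
  dual_constraint q s z2 Y -> psd (block_mx z1 z2 z2^T z3%:M) -> psd Y ->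
  type3 M mu Sigma gamma eta t x p ->
  \sum_k p k 0 * q k <= dual_value s z1 z2 z3 Y.
Proof.
move=> qle pZ pY tp; have [[p0 p1] _ _] := tp.
set W := block_mx (block_mx z1 z2 z2^T z3%:M) 0 0 Y.
have pW : psd W by apply/psd_block_diag.
have GW : 0 <= frob (\sum_k p k 0 *: moment_lmi k) W.
  by apply: frob_psd_ge0 => //; apply/moment_lmi_psd.
have : \sum_k p k 0 * q k
    <= \sum_k p k 0 * (dual_value s z1 z2 z3 Y - frob (moment_lmi k) W).
  apply: ler_sum => k _; apply: ler_wpM2l => //.
  by rewrite -moment_lmi_slack.
move=> /le_trans; apply; rewrite -subr_ge0.
suff -> : dual_value s z1 z2 z3 Y
    - \sum_k p k 0 * (dual_value s z1 z2 z3 Y - frob (moment_lmi k) W)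
    = frob (\sum_k p k 0 *: moment_lmi k) W by [].
rewrite frob_suml -{1}[dual_value _ _ _ _ _]mul1r -p1 mulr_suml -sumrB.
by apply: eq_bigr => k _; rewrite frobZl; ring.
Qed.

(** The multipliers are blocks of the matrix given by [lmi_strong_duality];
    [s] is whatever is left of [v], so that the value is [v] by
    construction. *)
Lemma type3_strong_duality (q : 'I_K -> R) v p0 :
  type3_strict M mu Sigma gamma eta t x p0 ->
  (forall p, type3 M mu Sigma gamma eta t x p -> \sum_k p k 0 * q k <= v) ->
  exists s z1 z2 z3 Y,
    [/\ dual_constraint q s z2 Y, psd (block_mx z1 z2 z2^T z3%:M), psd Y
      & dual_value s z1 z2 z3 Y = v].
Proof.
move=> sp0 vub; have [dp0 _ _] := sp0.
have [p dp /moment_lmi_psd-/(_ dp)/vub//|W [pW qW]] :=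
  lmi_strong_duality (q := q) (v := v) moment_lmi_sym dp0 (moment_lmi_posdef sp0).
have [pZ pY _] := psd_submx pW; have [_ _ Z21] := psd_submx pZ.
pose Z := ulsubmx W; pose z3 := drsubmx Z 0 0.
have ZE : Z = block_mx (ulsubmx Z) (ursubmx Z) (ursubmx Z)^T z3%:M.
  by rewrite -Z21 -mx11_scalar submxK.
pose s := v - dual_value 0 (ulsubmx Z) (ursubmx Z) z3 (drsubmx W).
have vE : dual_value s (ulsubmx Z) (ursubmx Z) z3 (drsubmx W) = v.
  by rewrite /s /dual_value; ring.
exists s, (ulsubmx Z), (ursubmx Z), z3, (drsubmx W); split=> //; last by rewrite -ZE.
move=> k; rewrite (moment_lmi_slack _ (ulsubmx Z) _ z3 _ (ursubmx W) (dlsubmx W)).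
by rewrite -ZE submxK vE lerBrDr.
Qed.

End Type3Duality.

(** * Attainment of the minimum over the decisions *)

Section Attainment.
Variable R : realType.

Lemma scalar_continuous I J
    (f : {linear ('cV[R]_I * 'M[R]_(I, J))%type -> R^o}) :
  continuous (fun z => f z : R).
Proof.
pose c1 (i : 'I_I) (j : 'I_1) : R := f (delta_mx i j, 0).
pose c2 (i : 'I_I) (j : 'I_J) : R := f (0, delta_mx i j).
rewrite (_ : (fun z => f z : R) = fun z =>
    \sum_i \sum_j c1 i j * z.1 i j + \sum_i \sum_j c2 i j * z.2 i j).
  move=> z; apply: (@continuousD _ _ _
    (fun z : 'cV[R]_I * 'M[R]_(I, J) => (\sum_i \sum_j c1 i j * z.1 i j : R))
    (fun z => \sum_i \sum_j c2 i j * z.2 i j)).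
    apply: (@continuous_comp _ _ _ fst
      (fun x : 'cV[R]_I => \sum_i \sum_j c1 i j * x i j)).
      exact: cvg_fst.
    exact: sum_coord_continuous.
  apply: (@continuous_comp _ _ _ snd
    (fun y : 'M[R]_(I, J) => \sum_i \sum_j c2 i j * y i j)).
    exact: cvg_snd.
  exact: sum_coord_continuous.
apply/funext => -[x y] /=.
have -> : (x, y) = \sum_i \sum_j x i j *: (delta_mx i j, 0) +
                   \sum_i \sum_j y i j *: (0, delta_mx i j).
  have pairE m1 n1 m2 n2 (p q : 'M[R]_(m1, n1) * 'M[R]_(m2, n2)) :
    p.1 = q.1 -> p.2 = q.2 -> p = q by case: p q => [? ?] [? ?] /= -> ->.
  have sum1 m n (g : 'I_m -> 'I_n -> 'cV[R]_I * 'M[R]_(I, J)) :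
      (\sum_i \sum_j g i j).1 = \sum_i \sum_j (g i j).1.
    by rewrite raddf_sum; apply: eq_bigr => i _; rewrite raddf_sum.
  have sum2 m n (g : 'I_m -> 'I_n -> 'cV[R]_I * 'M[R]_(I, J)) :
      (\sum_i \sum_j g i j).2 = \sum_i \sum_j (g i j).2.
    by rewrite raddf_sum; apply: eq_bigr => i _; rewrite raddf_sum.
  apply: pairE => /=.
    rewrite sum1 sum1 /= -matrix_sum_delta [X in _ + X]big1 ?addr0// => i _.
    by rewrite big1// => j _; rewrite scaler0.
  rewrite sum2 sum2 /= -matrix_sum_delta [X in X + _]big1 ?add0r// => i _.
  by rewrite big1// => j _; rewrite scaler0.
rewrite linearD /= !linear_sum; congr (_ + _); apply: eq_bigr => i _;
  rewrite linear_sum; apply: eq_bigr => j _; rewrite linearZ /=; exact: mulrC.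
Qed.

Lemma binary_locally_constant I (x x' : 'cV[R]_I) :
  binary x -> binary x' -> ball x 1 x' -> x' = x.
Proof.
move=> bx bx' [_ xx']; apply/matrixP => i j; rewrite (ord1 j).
have := xx' i 0; rewrite /ball /=.
case: (bx i) => ->; case: (bx' i) => -> //.
  by rewrite sub0r normrN normr1 ltxx.
by rewrite subr0 normr1 ltxx.
Qed.

(** The function [V] of the state is arbitrary: binary states at distance less
    than 1 coincide, so [V] is locally constant on [A], hence continuous
    there. *)
Lemma binary_state_attained I J
    (f : {linear ('cV[R]_I * 'M[R]_(I, J))%type -> R^o})
    (V : 'cV[R]_I -> R) (A : set ('cV[R]_I * 'M[R]_(I, J))) :
  A !=set0 -> compact A -> (forall z, A z -> binary z.1) ->
  exists2 z, A z & forall z', A z' -> (f z : R) + V z.1 <= (f z' : R) + V z'.1.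
Proof.
move=> A0 cA bA.
have cont : {within A, continuous (fun z => (f z : R) + V z.1)}.
  apply/subspace_continuousP => z Az; apply: cvgD.
    by apply: cvg_within_filter; apply: scalar_continuous.
  apply: cvg_near_cst; rewrite near_withinE.
  have zball : nbhs z (ball z 1) by apply: nbhsx_ballx.
  apply: filterS zball => z' [/= zz' _] Az'.
  by rewrite (binary_locally_constant (bA _ Az) (bA _ Az') zz').
have [z] := compact_EVT_min A0 cA cont.
rewrite inE => Az zmin; exists z => // z' Az'.
by apply: zmin; rewrite inE.
Qed.

Lemma inf_min (A : set R) v : is_minimum A v -> inf A = v.
Proof.
move=> [Av vlb]; apply/eqP; rewrite eq_le; apply/andP; split.
  by apply: ge_inf => //; exists v.
by apply: lb_le_inf => //; exists v.
Qed.

End Attainment.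

(** * The reformulation *)

Theorem theorem3 (R : realType) (I J K : nat)
    (I_gt0 : (0 < I)%N) (J_gt0 : (0 < J)%N) (K_gt0 : (0 < K)%N)
    (M : problem R I J K) (wpM : well_posed M)
    (mu : nat -> 'cV[R]_I -> 'cV[R]_J) (Sigma : nat -> 'cV[R]_I -> 'M[R]_J)
    (Sigma_posdef : forall t x, binary x -> posdef (Sigma t x))
    (gamma eta : R)
    (t : nat) (ht : (2 <= t < horizon M)%N)
    (xprev : 'cV[R]_I) (hxprev : feasible_state M t.-1 xprev)
    (xi : 'cV[R]_J) (hxi : realizations M t xi)
    (slater : forall x, feas_proj M t xprev xi x ->
       exists p, type3_strict M mu Sigma gamma eta t.+1 x p) :
  let Q := value M (type3 M mu Sigma gamma eta) in
  is_minimum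
    [set v : R | exists (x : 'cV[R]_I) (y : 'M[R]_(I, J)) (s : R)
                    (z1 : 'M[R]_J) (z2 : 'cV[R]_J) (z3 : R) (Y : 'M[R]_J),
      let m := mu t.+1 x in
      let S := Sigma t.+1 x in
      [/\ forall k : 'I_K,
            let xik := scenario M t.+1 k in
            s - 2 * (z2^T *m xik) 0 0
              + frob ((xik - m) *m (xik - m)^T) Y >= Q t.+1 x xik,
          psd (block_mx z1 z2 z2^T z3%:M),
          psd Y,
          feas M t xprev xi (x, y)
        & v = (cost M t (x, y) : R) + s + frob S z1 - 2 * (m^T *m z2) 0 0
              + gamma * z3 + eta * frob S Y]]
    (Q t xprev xi).
Proof.
move=> Q.
have /andP[t2 tT] := ht.
have [_ wp] := wpM.
have t_range : (1 <= t <= horizon M)%N by rewrite (ltnW t2) ltnW.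
have [feas0 feas_compact [? [? [? [? feasE]]]]] := wp t xprev xi t_range hxprev hxi.
have feas_bin z : feas M t xprev xi z -> binary z.1 by rewrite feasE => -[].
pose worst x := [set \sum_k p k 0 * Q t.+1 x (scenario M t.+1 k)
                | p in type3 M mu Sigma gamma eta t.+1 x].
have worst_ub x p : type3 M mu Sigma gamma eta t.+1 x p ->
    \sum_k p k 0 * Q t.+1 x (scenario M t.+1 k) <= sup (worst x).
  move=> tp; apply: ub_le_sup; last by exists p.
  exists (\sum_k `|Q t.+1 x (scenario M t.+1 k)|) => _ [p' [[p'0 p'1] _ _] <-].
  apply: ler_sum => k _; apply: le_trans (ler_norm _) _.
  rewrite normrM ger0_norm// ler_piMl// -p'1 (bigD1 k)//= lerDl.
  exact: sumr_ge0.
have dual_ge x y s z1 z2 z3 Y : feas M t xprev xi (x, y) ->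
    dual_constraint M mu t.+1 x (fun k => Q t.+1 x (scenario M t.+1 k)) s z2 Y ->
    psd (block_mx z1 z2 z2^T z3%:M) -> psd Y ->
    sup (worst x) <= dual_value mu Sigma gamma eta t.+1 x s z1 z2 z3 Y.
  move=> xy_feas cons pZ pY.
  have Spd : posdef (Sigma t.+1 x) := Sigma_posdef t.+1 _ (feas_bin _ xy_feas).
  apply: ge_sup => [|_ [p tp <-]]; last exact: type3_weak_duality tp.
  have [|p [dp lt_p pd_p]] := slater x; first by exists y.
  exists (\sum_k p k 0 * Q t.+1 x (scenario M t.+1 k)), p => //.
  by split=> //; [exact: ltW | exact: posdef_psd].
have objE x y s z1 z2 z3 Y :
    (cost M t (x, y) : R) + s + frob (Sigma t.+1 x) z1
      - 2 * ((mu t.+1 x)^T *m z2) 0 0 + gamma * z3 + eta * frob (Sigma t.+1 x) Y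
    = (cost M t (x, y) : R) + dual_value mu Sigma gamma eta t.+1 x s z1 z2 z3 Y.
  by rewrite /dual_value !addrA.
have [[x y] xy_feas xy_min] :=
  binary_state_attained (cost M t) (fun x => sup (worst x)) feas0 feas_compact feas_bin.
have -> : Q t xprev xi = (cost M t (x, y) : R) + sup (worst x).
  rewrite {1}/Q value_bellman//; apply: inf_min; split; first by exists (x, y).
  by move=> _ [z z_feas <-]; exact: xy_min.
split=> [|_ [x' [y' [s [z1 [z2 [z3 [Y [cons pZ pY xy'_feas ->]]]]]]]]]; last first.
  rewrite objE; apply: le_trans (xy_min _ xy'_feas) _; rewrite lerD2l.
  exact: (dual_ge _ _ _ _ _ _ _ xy'_feas cons pZ pY).
have Spd : posdef (Sigma t.+1 x) := Sigma_posdef t.+1 _ (feas_bin _ xy_feas).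
have [|p0 sp0] := slater x; first by exists y.
have [s [z1 [z2 [z3 [Y [cons pZ pY dualE]]]]]] :=
  type3_strong_duality Spd sp0 (@worst_ub x).
by exists x, y, s, z1, z2, z3, Y; split=> //; rewrite objE dualE.
Qed.
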